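(* Let $s\geq 4$ be an even integer. For every integer $n\geq 0$, \[ M_{s}(n)=C_{s}(n)=D_{s}(n). \]
   Context: $M_s(n)$ is the number of partitions of $n$ in which every part occurs with multiplicity congruent to $0$ or $1$ modulo $s$. $C_s(n)$ is the number of partitions of $n$ none of whose parts is congruent to $2,4,\dots,s-2$ modulo $s$. $D_s(n)$ is the number of partitions of $n$ in which every part occurring with multiplicity greater than one is divisible by $s/2$. All three equal $1$ for $n=0$. *)

(* Defs.v *)
From HB Require Import structures.
From mathcomp Require Import all_boot.

Set Implicit Arguments.
Unset Strict Implicit.
Unset Printing Implicit Defensive.

Definition is_partition (n : nat) (p : seq nat) : bool :=
  [&& sorted geq p, 0 \notin p & sumn p == n].

Record partition_of (n : nat) := PartitionOf {
  parts :> seq nat;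
  partsP : is_partition n parts
}.

HB.instance Definition _ n := [isSub for @parts n].
HB.instance Definition _ n := [Countable of partition_of n by <:].

Section PartitionFinite.
Variable n : nat.

Fact size_parts (p : partition_of n) : size p <= n.
Proof.
case: p => p /= /and3P[_ p0 /eqP <-]; elim: p p0 => //= x p IHp.
rewrite inE negb_or eq_sym -lt0n => /andP[x_gt0 /IHp le_p].
by rewrite -add1n leq_add.
Qed.

Fact mem_parts_leq (p : partition_of n) k : k \in parts p -> k <= n.
Proof.
case: p => p /= /and3P[_ _ /eqP <-]; elim: p => //= x p IHp.
rewrite inE => /orP[/eqP-> | /IHp le_kp]; first exact: leq_addr.
exact: leq_trans le_kp (leq_addl _ _).
Qed.

(* Finiteness: a partition of n has at most n parts, each at most n. *)
Definition partition_bseq (p : partition_of n) : n.-bseq 'I_n.+1 :=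
  insub_bseq n [seq inord k | k <- parts p].

Definition bseq_partition (t : n.-bseq 'I_n.+1) : option (partition_of n) :=
  insub [seq val i | i <- t].

Fact partition_bseqK : pcancel partition_bseq bseq_partition.
Proof.
move=> p; rewrite /bseq_partition /partition_bseq.
rewrite /insub_bseq insubdK; last by rewrite -topredE /= size_map size_parts.
rewrite -map_comp map_id_in ?valK // => k /mem_parts_leq le_kn.
by rewrite /= inordK.
Qed.

End PartitionFinite.

HB.instance Definition _ n :=
  isFinite.Build (partition_of n) (pcan_enumP (@partition_bseqK n)).

Definition multiplicity (k : nat) (p : seq nat) : nat := count_mem k p.

Definition M (s n : nat) : nat :=
  #|[set p : partition_of n |
      all (fun k => (multiplicity k p == 0 %[mod s])
                    || (multiplicity k p == 1 %[mod s])) p]|.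

(* The excluded residues 2, 4, ..., s - 2 are the 2 * j with 1 <= j < s / 2. *)
Definition C (s n : nat) : nat :=
  #|[set p : partition_of n |
      all (fun k => all (fun j => k != 2 * j %[mod s])
                        (index_iota 1 (s %/ 2))) p]|.

Definition D (s n : nat) : nat :=
  #|[set p : partition_of n |
      all (fun k => (1 < multiplicity k p) ==> (s %/ 2 %| k)) p]|.

(* Main.v *)
Require Import Defs.
From mathcomp Require Import all_boot.
From mathcomp Require Import all_algebra zify.

(* Write U = prod_k (1 - X^(s k)). The generating functions of M_s, C_s and D_s
   are products over the part sizes k, and multiplying each of them by U gives
   the same product prod_k (1 + X^k):
   - for M_s, (1 - X^(s k)) * sum_(m = 0, 1 mod s) X^(k m) = 1 + X^k;
   - for C_s, U cancels the factors with s | k and leaves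
     prod_(k odd) 1 / (1 - X^k), which is Euler's product;
   - for D_s, with s = 2 h, the factor 1 - X^(2 k) of U turns the factor
     1 / (1 - X^k) at h | k into 1 + X^k.
   Power series are replaced by polynomials modulo X^(n + 1), where U is
   invertible. *)

Set Implicit Arguments.
Unset Strict Implicit.
Unset Printing Implicit Defensive.

Import GRing.Theory.
Local Open Scope ring_scope.

(** * Polynomial congruences modulo [X^N] *)

Lemma take_polyM (R : nzSemiRingType) (N : nat) (p q : {poly R}) :
  take_poly N (p * q) = take_poly N (take_poly N p * take_poly N q).
Proof.
apply/polyP => i; rewrite !coef_take_poly; case: ltnP => // lt_iN.
rewrite !coefM; apply: eq_bigr => j _; rewrite !coef_take_poly.
by rewrite !(leq_ltn_trans _ lt_iN) ?leq_subr // -ltnS.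
Qed.

Section CongruenceModXn.
Variables (R : comNzRingType) (N : nat).
Implicit Types p q u v : {poly R}.

Definition eqmodXn p q : Prop := take_poly N p = take_poly N q.

Lemma eqmodXnM p p' q q' :
  eqmodXn p p' -> eqmodXn q q' -> eqmodXn (p * q) (p' * q').
Proof. by rewrite /eqmodXn => Ep Eq; rewrite take_polyM Ep Eq -take_polyM. Qed.

Lemma eqmodXn_prod (I : eqType) (r : seq I) (P : pred I) (F G : I -> {poly R}) :
    (forall i, i \in r -> P i -> eqmodXn (F i) (G i)) ->
  eqmodXn (\prod_(i <- r | P i) F i) (\prod_(i <- r | P i) G i).
Proof.
move=> EFG; rewrite big_seq_cond [in X in eqmodXn _ X]big_seq_cond.
by apply: big_ind2 => [||i /andP[]]; [|exact: eqmodXnM|exact: EFG].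
Qed.

Lemma eqmodXn_prod1 (I : eqType) (r : seq I) (P : pred I) (F : I -> {poly R}) :
    (forall i, i \in r -> P i -> eqmodXn (F i) 1) ->
  eqmodXn (\prod_(i <- r | P i) F i) 1.
Proof.
by move=> EF1; apply: etrans (eqmodXn_prod EF1) _; rewrite big1_eq.
Qed.

Lemma eqmodXn_mull_inj u v p q :
  eqmodXn (v * u) 1 -> eqmodXn (u * p) (u * q) -> eqmodXn p q.
Proof.
move=> Evu /(eqmodXnM (erefl (take_poly N v))); rewrite !mulrA.
have E1 t : eqmodXn (v * u * t) t by rewrite -[X in eqmodXn _ X]mul1r; exact: eqmodXnM.
by rewrite /eqmodXn !E1.
Qed.

Lemma take_Xn_ge m p : (N <= m)%N -> take_poly N ('X^m * p) = 0.
Proof.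
move=> le_Nm; apply/polyP => i; rewrite coef_take_poly coef0 coefXnM.
by case: ltnP => // lt_iN; rewrite (leq_trans lt_iN).
Qed.

Lemma eqmodXn_1subXn m : (N <= m)%N -> eqmodXn (1 - 'X^m) 1.
Proof.
by move=> le_Nm; rewrite /eqmodXn raddfB /= -['X^m]mulr1 take_Xn_ge ?subr0.
Qed.

(** The product telescopes to [1 - X^(k * N)], and [k * N >= N]. *)
Lemma eqmodXn_geometric k : (0 < k)%N ->
  eqmodXn ((1 - 'X^k) * \sum_(0 <= m < N) 'X^(k * m)) 1.
Proof.
move=> k_gt0; under eq_bigr do rewrite exprM.
rewrite big_mkord -opprB mulNr -subrX1 opprB -exprM.
by apply: eqmodXn_1subXn; rewrite leq_pmull.
Qed.

(** Reindexing by [k = d * j] gives the multiples of [d] up to [d * n]; those beyond [n] contribute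
    1. This lets the factors of U be matched with part sizes. *)
Lemma eqmodXn_prod_dvdn (d n : nat) (F : nat -> {poly R}) :
    (0 < d)%N -> (forall k, n < k -> eqmodXn (F k) 1)%N ->
  eqmodXn (\prod_(1 <= j < n.+1) F (d * j)%N)
          (\prod_(1 <= k < n.+1 | (d %| k)%N) F k).
Proof.
move=> d_gt0 F1.
have -> : \prod_(1 <= j < n.+1) F (d * j)%N =
          \prod_(1 <= k < (d * n).+1 | (d %| k)%N) F k.
  elim: n {F1} => [|n IHn]; first by rewrite muln0 !big_geq.
  rewrite big_nat_recr //= IHn mulnS.
  rewrite [RHS](big_cat_nat (n := (d * n).+1)) //=; last by lia.
  (* Among the [d] new indices only the last one is a multiple of [d]. *)
  congr (_ * _); rewrite big_mkcond addnC big_nat_recr /=; last by lia.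
  rewrite dvdn_addr ?dvdn_mulr // dvdnn big_nat_cond big1 ?mul1r // => k.
  rewrite andbT => /andP[lt_dnk lt_kdn]; case: ifP => // /dvdnP[j Ej].
  move: lt_dnk lt_kdn; rewrite Ej -mulnSr (mulnC j) !ltn_pmul2l //.
  by move=> lt_nj; rewrite ltnS leqNgt lt_nj.
rewrite (big_cat_nat (n := n.+1)) //=; last by rewrite ltnS leq_pmull.
rewrite -[X in eqmodXn _ X]mulr1; apply: eqmodXnM => //.
by apply: eqmodXn_prod1 => k; rewrite mem_index_iota => /andP[/F1].
Qed.

(* Prepending one period of exponents gives S (N + s) = 1 + x + x^s S N. *)
Lemma eqmodXn_mod01 s k : (1 < s)%N -> (0 < k)%N ->
  eqmodXn ((1 - 'X^(s * k)) * \sum_(0 <= m < N | (m %% s < 2)%N) 'X^(k * m))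
          (1 + 'X^k).
Proof.
move=> s_gt1 k_gt0; pose S n : {poly R} := \sum_(0 <= m < n | (m %% s < 2)%N) 'X^(k * m).
rewrite -/(S N).
have ES : S (N + s)%N = 1 + 'X^k + 'X^(s * k) * S N.
  rewrite /S (big_cat_nat (n := s)) ?leq_addl //=; congr (_ + _).
    rewrite big_ltn_cond ?(ltnW s_gt1) // mod0n /= big_ltn_cond // modn_small //=.
    rewrite muln0 expr0 muln1 big_nat_cond big1 ?addr0 // => m /andP[/andP[m2 ms]].
    by rewrite modn_small // ltnNge m2.
  rewrite big_distrr -[X in index_iota X]add0n big_addn addnK /=.
  apply: eq_big => [m|m _]; first by rewrite modnDr.
  by rewrite mulnDr addnC exprD mulnC.
(* The additional terms have exponents [k * m >= N], so truncation removes them. *)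
have ESN : eqmodXn (S (N + s)%N) (S N).
  rewrite /eqmodXn /S (big_cat_nat (n := N)) ?leq_addr //= raddfD /=.
  rewrite [X in _ + X]raddf_sum /= [X in _ + X]big_nat_cond [X in _ + X]big1 ?addr0 //.
  move=> m /andP[/andP[le_Nm _] _]; rewrite -['X^_]mulr1 take_Xn_ge //.
  by rewrite (leq_trans le_Nm) // leq_pmull.
by rewrite mulrBl mul1r /eqmodXn raddfB /= -ESN -raddfB /= ES addrK.
Qed.

End CongruenceModXn.

(** * Partitions as multiplicity functions, and their generating product *)

Lemma sumn_count_mem n (p : seq nat) : 0%N \notin p -> all (fun k => k <= n)%N p ->
  sumn p = (\sum_(k < n) k.+1 * count_mem k.+1 p)%N.
Proof.
elim: p => [|x p IHp] /=; first by rewrite big1 // => k _; rewrite muln0.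
rewrite inE negb_or eq_sym -lt0n => /andP[x_gt0 p0] /andP[le_xn le_pn].
under eq_bigr do rewrite mulnDr; rewrite big_split /= -IHp //; congr (_ + _)%N.
have lt_xn : (x.-1 < n)%N by rewrite prednK.
rewrite (bigD1 (Ordinal lt_xn)) //= prednK // eqxx muln1 big1 ?addn0 // => k.
rewrite -val_eqE /= => neq_kx; rewrite [x == _]eq_sym.
suff /negPf -> : k.+1 != x by rewrite muln0.
by apply: contraNneq neq_kx => <-.
Qed.

Section PartitionsByMultiplicity.
Variables (n : nat) (A : nat -> pred nat).
Hypothesis A0 : forall k, A k 0.

(** Index [k] stands for part size [k.+1]. A partition of [n] has at most [n] parts, so [inord]
    never falls back to its default. *)
Definition partition_counts (p : partition_of n) : {ffun 'I_n -> 'I_n.+1} :=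
  [ffun k : 'I_n => inord (count_mem k.+1 (parts p))].

Lemma partition_countsE p k :
  partition_counts p k = count_mem k.+1 (parts p) :> nat.
Proof.
by rewrite ffunE inordK // ltnS (leq_trans (count_size _ _)) ?size_parts.
Qed.

Lemma count_mem_part_out (p : partition_of n) k : ~~ (0 < k <= n)%N ->
  count_mem k (parts p) = 0%N.
Proof.
move=> k_out; apply/count_memPn; apply: contra k_out => kp.
rewrite (mem_parts_leq kp) andbT lt0n; apply: contraTneq kp => ->.
by case: p => p /= /and3P[].
Qed.

Lemma partition_counts_inj : injective partition_counts.
Proof.
move=> p q Epq; apply/val_inj.
have geq_tr : transitive geq by move=> a b c /= ba cb; apply: leq_trans cb ba.
have geq_anti : antisymmetric geq by move=> a b; rewrite /= andbC; apply: anti_leq.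
have [/and3P[sp _ _] /and3P[sq _ _]] := (partsP p, partsP q).
apply: (sorted_eq geq_tr geq_anti sp sq); apply/allP => k _ /=; apply/eqP.
have [/andP[k_gt0 le_kn]|k_out] := boolP (0 < k <= n)%N; last first.
  by rewrite !count_mem_part_out.
have lt_kn : (k.-1 < n)%N by rewrite prednK.
have := congr1 (fun f : {ffun 'I_n -> 'I_n.+1} => f (Ordinal lt_kn) : nat) Epq.
by rewrite !partition_countsE /= prednK.
Qed.

Lemma partition_countsK (f : {ffun 'I_n -> 'I_n.+1}) :
  (\sum_(k < n) k.+1 * f k)%N = n -> exists p, partition_counts p = f.
Proof.
move=> f_sum.
(* The witness has [f k] copies of each [k.+1]; sorting it makes it a partition. *)
pose q := flatten [seq nseq (f k) (k : nat).+1 | k <- enum 'I_n].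
have q_count (k : 'I_n) : count_mem k.+1 q = f k.
  rewrite count_flatten -map_comp sumnE big_map big_enum /= (bigD1 k) //=.
  rewrite count_nseq /= eqxx mul1n big1 ?addn0 // => i neq_ik.
  by rewrite count_nseq /= eqSS val_eqE (negPf neq_ik).
have q_mem k : k \in q -> (0 < k <= n)%N.
  by case/flattenP => _ /mapP[i _ ->] /nseqP[-> _] /=.
have q_part : is_partition n (sort geq q).
  apply/and3P; split.
  - by apply: sort_sorted => a b; apply: leq_total.
  - by rewrite mem_sort; apply: contraT; rewrite negbK => /q_mem.
  rewrite (perm_sumn (permEl (perm_sort geq q))) (@sumn_count_mem n).
  - by under eq_bigr do rewrite q_count; apply/eqP.
  - by apply: contraT; rewrite negbK => /q_mem.
  by apply/allP => k /q_mem/andP[].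
exists (PartitionOf q_part); apply/ffunP => k; apply/val_inj.
by rewrite /= partition_countsE /= (permP (permEl (perm_sort geq q))) q_count.
Qed.

Lemma sum_partition_counts (p : partition_of n) :
  (\sum_(k < n) k.+1 * partition_counts p k)%N = n.
Proof.
under eq_bigr do rewrite partition_countsE.
have /and3P[_ p0 /eqP Esum] := partsP p.
by rewrite -sumn_count_mem //; apply/allP => k; apply: mem_parts_leq.
Qed.

(** Expanding the product chooses a multiplicity for every size up to [n], and the coefficient keeps
    the choices of total [n]. The predicate on partitions tests only sizes that occur; [A0] covers
    the absent ones. *)
Lemma card_partitions_by_multiplicity (R : comNzRingType) :
  #|[set p : partition_of n | all (fun k => A k (multiplicity k p)) p]|%:R =
  (\prod_(1 <= k < n.+1) \sum_(0 <= m < n.+1 | A k m) 'X^(k * m))`_n :> R.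
Proof.
rewrite big_add1 /= big_mkord; under eq_bigr do rewrite big_mkord.
rewrite bigA_distr_big_dep coef_sum.
under eq_bigr => f _ do rewrite prodrXr coefXn mulrb.
rewrite -big_mkcondr /= sumr_const -(card_imset _ partition_counts_inj).
congr (_%:R); apply: eq_card => f; rewrite [RHS]unfold_in.
apply/imsetP/andP => [[p] | [/familyP fA /eqP/esym/partition_countsK[p Ep]]].
  rewrite inE => /allP pA ->; split; last by rewrite sum_partition_counts.
  apply/familyP => k; rewrite unfold_in partition_countsE.
  have [/pA//|/count_memPn-> //] := boolP (k.+1 \in parts p).
exists p => //; rewrite inE; apply/allP => k kp.
have [k0|] := posnP k.
  by move: kp; rewrite k0; case/and3P: (partsP p) => _ /negPf->.
move=> k_gt0; have lt_kn : (k.-1 < n)%N by rewrite prednK // (mem_parts_leq kp).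
have := fA (Ordinal lt_kn).
by rewrite -Ep unfold_in partition_countsE /= prednK.
Qed.

End PartitionsByMultiplicity.

(** * Euler's identity and the three products multiplied by U *)

Section ProductIdentities.
Variables (R : comNzRingType) (n : nat).

Local Notation "p =X q" := (@eqmodXn R n.+1 p q) (at level 70).
Local Notation geom k := (\sum_(0 <= m < n.+1) 'X^(k * m) : {poly R}).

Lemma eqmodXn_prod_1subXn s : (0 < s)%N ->
  (\prod_(1 <= k < n.+1) geom (s * k)) * \prod_(1 <= k < n.+1) (1 - 'X^(s * k))
    =X 1.
Proof.
move=> s_gt0; rewrite -big_split /=; apply: eqmodXn_prod1 => k.
rewrite mem_index_iota => /andP[k_gt0 _] _; rewrite mulrC.
by apply: eqmodXn_geometric; rewrite muln_gt0 s_gt0.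
Qed.

(** After multiplication by the invertible product of the [1 - X^k], both sides become the product
    of the [1 - X^k] over even [k]: on the left through [(1 - X^k) * (1 + X^k) = 1 - X^(2 * k)], on
    the right because the odd factors cancel. *)
Lemma eqmodXn_Euler :
  \prod_(1 <= k < n.+1) (1 + 'X^k) =X
  \prod_(1 <= k < n.+1) (if odd k then geom k else 1).
Proof.
have Q_unit := @eqmodXn_prod_1subXn 1 isT.
apply: (eqmodXn_mull_inj Q_unit); rewrite -!big_split /=.
under eq_bigr => k _ do rewrite mul1n -subr_sqr expr1n -exprM mulnC.
have F1 k : (n < k)%N -> 1 - 'X^k =X 1 by exact: eqmodXn_1subXn.
apply: (etrans (eqmodXn_prod_dvdn (d := 2) isT F1)); rewrite big_mkcond.
apply: eqmodXn_prod => k; rewrite mem_index_iota => /andP[k_gt0 _] _.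
rewrite mul1n dvdn2; case: (odd k) => /=; last by rewrite mulr1.
by apply/esym; apply: eqmodXn_geometric.
Qed.

Lemma eqmodXn_M s : (1 < s)%N ->
  (\prod_(1 <= k < n.+1) (1 - 'X^(s * k))) *
  (\prod_(1 <= k < n.+1) \sum_(0 <= m < n.+1 | (m %% s < 2)%N) 'X^(k * m)) =X
  \prod_(1 <= k < n.+1) (1 + 'X^k).
Proof.
move=> s_gt1; rewrite -big_split /=; apply: eqmodXn_prod => k.
by rewrite mem_index_iota => /andP[k_gt0 _] _; apply: eqmodXn_mod01.
Qed.

Lemma eqmodXn_C s : (0 < s)%N -> ~~ odd s ->
  (\prod_(1 <= k < n.+1) (1 - 'X^(s * k))) *
  (\prod_(1 <= k < n.+1)
     \sum_(0 <= m < n.+1 | (odd k || (s %| k)%N) || (m == 0)%N) 'X^(k * m)) =X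
  \prod_(1 <= k < n.+1) (1 + 'X^k).
Proof.
move=> s_gt0 s_even; apply: etrans _ (esym eqmodXn_Euler).
have F1 k : (n < k)%N -> 1 - 'X^k =X 1 by exact: eqmodXn_1subXn.
apply: etrans (eqmodXnM (eqmodXn_prod_dvdn s_gt0 F1) erefl) _.
rewrite big_mkcond -big_split /=; apply: eqmodXn_prod => k.
rewrite mem_index_iota => /andP[k_gt0 _] _.
have [s_k|s'k] := boolP (s %| k)%N.
  have /negPf-> : ~~ odd k by rewrite -dvdn2 (dvdn_trans _ s_k) // dvdn2.
  by apply: eqmodXn_geometric.
rewrite mul1r orbF; case: (odd k) => //=.
rewrite big_ltn_cond //= muln0 expr0 big_nat_cond big1 ?addr0 //.
by case=> // m; rewrite andbF.
Qed.

Lemma eqmodXn_D h : (0 < h)%N ->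
  (\prod_(1 <= k < n.+1) (1 - 'X^(2 * h * k))) *
  (\prod_(1 <= k < n.+1)
     \sum_(0 <= m < n.+1 | (1 < m)%N ==> (h %| k)%N) 'X^(k * m)) =X
  \prod_(1 <= k < n.+1) (1 + 'X^k).
Proof.
move=> h_gt0; have F1 k : (n < k)%N -> 1 - 'X^(2 * k) =X 1.
  by move=> lt_nk; apply: eqmodXn_1subXn; rewrite (leq_trans lt_nk) ?leq_pmull.
under eq_bigr do rewrite -mulnA.
apply: etrans (eqmodXnM (eqmodXn_prod_dvdn h_gt0 F1) erefl) _.
rewrite big_mkcond -big_split /=; apply: eqmodXn_prod => k.
rewrite mem_index_iota => /andP[k_gt0 lt_kn].
have [h_k|h'k] := boolP (h %| k)%N => _.
  under eq_bigl do rewrite implybT.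
  rewrite mulnC exprM -['X^k ^+ 2]mul1r -{1}(expr1n _ 2) mul1r subr_sqr.
  rewrite [(1 - _) * _]mulrC -mulrA -[X in _ =X X]mulr1.
  by apply: eqmodXnM => //; apply: eqmodXn_geometric.
(* Only [m = 0] and [m = 1] remain; [m = 1] is in range since [0 < k <= n]. *)
rewrite mul1r big_ltn_cond //= big_ltn_cond; last by rewrite (leq_trans _ lt_kn).
rewrite muln0 expr0 /= muln1 big_nat_cond big1 ?addr0 // => m.
by rewrite implybF -andbA => /and3P[m_gt1 _]; rewrite m_gt1.
Qed.

End ProductIdentities.

(** * From the counts to coefficients and back *)

Lemma excluded_residuesE s k : ~~ odd s -> (0 < s)%N ->
  all (fun j => k != 2 * j %[mod s])%N (index_iota 1 (s %/ 2)) =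
  odd k || (s %| k)%N.
Proof.
move=> s_even s_gt0; have Es : s = (2 * (s %/ 2))%N.
  by rewrite mulnC divnK // dvdn2.
have odd_mod m : odd (m %% s) = odd m.
  by rewrite {2}(divn_eq m s) oddD oddM (negPf s_even) andbF.
apply/allP/idP => [k_res|k_ok j].
  apply: contraT; rewrite negb_or => /andP[k_even s'k].
  (* As [s] is even, [k %% s] is a nonzero even residue, hence twice this index. *)
  have /k_res : ((k %% s) %/ 2)%N \in index_iota 1 (s %/ 2).
    have := ltn_pmod k s_gt0; move: s'k k_even; rewrite /dvdn -odd_mod mem_index_iota.
    by lia.
  by rewrite mulnC divnK ?modn_mod ?eqxx // dvdn2 odd_mod.
rewrite mem_index_iota => /andP[j_gt0 lt_js]; apply: contraTneq k_ok => Ek.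
rewrite -odd_mod /dvdn Ek odd_mod oddM /= modn_small; last by lia.
by lia.
Qed.

Lemma natr_M (R : comNzRingType) s n : (1 < s)%N ->
  (M s n)%:R = (\prod_(1 <= k < n.+1)
    \sum_(0 <= m < n.+1 | (m %% s < 2)%N) 'X^(k * m))`_n :> R.
Proof.
move=> s_gt1.
rewrite -(@card_partitions_by_multiplicity n (fun _ m => m %% s < 2)%N).
  congr (_%:R); apply: eq_card => p; rewrite !inE; apply: eq_all => k.
  by rewrite mod0n (modn_small s_gt1); case: (_ %% s)%N => [|[]].
by move=> _; rewrite mod0n.
Qed.

(** A forbidden size is one whose multiplicity must be 0, which turns a condition on sizes into one
    on multiplicities. *)
Lemma natr_C (R : comNzRingType) s n : (0 < s)%N -> ~~ odd s ->
  (C s n)%:R = (\prod_(1 <= k < n.+1)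
    \sum_(0 <= m < n.+1 | (odd k || (s %| k)%N) || (m == 0)%N) 'X^(k * m))`_n
    :> R.
Proof.
move=> s_gt0 s_even; rewrite -(@card_partitions_by_multiplicity n
  (fun k m => (odd k || (s %| k)%N) || (m == 0)%N)).
  congr (_%:R); apply: eq_card => p; rewrite !inE; apply: eq_in_all => k kp.
  by rewrite excluded_residuesE // -leqn0 leqNgt -has_count has_pred1 kp orbF.
by move=> k; rewrite orbT.
Qed.

Lemma natr_D (R : comNzRingType) s n :
  (D s n)%:R = (\prod_(1 <= k < n.+1)
    \sum_(0 <= m < n.+1 | (1 < m)%N ==> (s %/ 2 %| k)%N) 'X^(k * m))`_n :> R.
Proof.
by rewrite -(@card_partitions_by_multiplicity n
  (fun k m => (1 < m)%N ==> (s %/ 2 %| k)%N)).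
Qed.

(** Truncation at [n.+1] preserves coefficient [n], and naturals embed injectively in [int]. *)
Lemma eqmodXn_natr_inj n a b (p q u v : {poly int}) :
    a%:R = p`_n -> b%:R = q`_n -> eqmodXn n.+1 (v * u) 1 ->
  eqmodXn n.+1 (u * p) (u * q) -> a = b.
Proof.
move=> Ea Eb u_unit /(eqmodXn_mull_inj u_unit).
move/(congr1 (fun r : {poly int} => r`_n)); rewrite !coef_take_poly ltnSn.
by rewrite -Ea -Eb !natz => -[].
Qed.

Local Close Scope ring_scope.

Theorem theorem5 (s : nat) (s_ge4 : 4 <= s) (s_even : ~~ odd s) (n : nat) :
  M s n = C s n /\ C s n = D s n.
Proof.
have s_gt0 : 0 < s by lia.
have s_gt1 : 1 < s by lia.
have Es : s = 2 * (s %/ 2) by rewrite mulnC divnK // dvdn2.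
have h_gt0 : 0 < s %/ 2 by lia.
have U_unit := @eqmodXn_prod_1subXn int n s s_gt0.
have U_M := @eqmodXn_M int n s s_gt1.
have U_C := @eqmodXn_C int n s s_gt0 s_even.
(* Replacing [2 * (s %/ 2)] by [s] makes U the same in all three identities. *)
have U_D := @eqmodXn_D int n _ h_gt0; rewrite -Es in U_D.
split.
  apply: (eqmodXn_natr_inj (natr_M _ _ s_gt1) (natr_C _ _ s_gt0 s_even) U_unit).
  exact: etrans U_M (esym U_C).
apply: (eqmodXn_natr_inj (natr_C _ _ s_gt0 s_even) (natr_D _ _ _) U_unit).
exact: etrans U_C (esym U_D).
Qed.
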